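(* Let $1\le r\le s\le t$ and $n=r+s+t+1$. Then $$n+3=r+s+t+4\le D^{f}_{2r+1}(E3C(r,s,t))\le D_{2r+2}(E3C(r,s,t))\le r+s+t+6=n+5.$$
   Context: The exchanged 3-ary $n$-cube $E3C(r,s,t)$ ($r,s,t\ge1$, $n=r+s+t+1$): vertices are strings written $x=ABCd$ with $A\in\{0,1,2\}^r$, $B\in\{0,1,2\}^s$, $C\in\{0,1,2\}^t$, $d\in\{0,1,2\}$. Two distinct vertices $x=ABCd$, $y=A'B'C'd'$ are adjacent iff one of: (E0) $A=A',B=B',C=C'$ and $d\ne d'$; (E1) $d=d'=0$, $A=A'$, $B=B'$ and $C,C'$ differ in exactly one position; (E2) $d=d'=1$, $A=A'$, $C=C'$ and $B,B'$ differ in exactly one position; (E3) $d=d'=2$, $B=B'$, $C=C'$ and $A,A'$ differ in exactly one position. For a connected graph $G$ with vertex connectivity $\kappa(G)$: the $\alpha$-fault diameter ($1\le\alpha\le\kappa(G)-1$) is $D^f_\alpha(G)=\max\{d_{G-F}(u,v): u\ne v,\ F\subseteq V(G)\setminus\{u,v\},\ |F|=\alpha\}$; the $\beta$-wide diameter ($1\le\beta\le\kappa(G)$) $D_\beta(G)$ is the maximum over distinct $u,v$ of the minimum, over all families of $\beta$ pairwise internally disjoint $u$–$v$ paths, of the maximum length of a path in the family. (It is known that $\kappa(E3C(r,s,t))=2r+2$ when $r\le s\le t$.) *)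

(* Defs.v *)
From Stdlib Require Import ClassicalEpsilon.
From mathcomp Require Import all_boot.
Set Implicit Arguments. Unset Strict Implicit. Unset Printing Implicit Defensive.

Definition pbool (P : Prop) : bool :=
  if excluded_middle_informative P then true else false.

(* least k <= N satisfying P; returns N.+1 (a value larger than every
   candidate, standing for +infinity) if there is none. *)
Definition least_upto (N : nat) (P : nat -> Prop) : nat :=
  find (fun k => pbool (P k)) (iota 0 N.+1).

Section Graph.
Variables (V : finType) (adj : rel V).

(* p = [:: u; x1; ...; v] is a u-v path (distinct vertices, consecutive
   vertices adjacent); its length is size p - 1. *)
Definition is_path (u v : V) (p : seq V) : Prop :=
  [/\ head u p = u, size p > 0, last u p = v, path adj u (behead p) & uniq p].

Definition interior (p : seq V) : seq V := take (size p - 2) (behead p).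

(* d_{G-F}(u,v): length of a shortest u-v path in G - F.
   Every path has length <= #|V| - 1, so the value #|V|.+1 encodes "no path"
   (distance +infinity). *)
Definition dist_avoid (F : {set V}) (u v : V) : nat :=
  least_upto #|V| (fun k => exists p, is_path u v p /\ size p = k.+1 /\
                                   all (fun x => x \notin F) p).

Definition fault_diam (alpha : nat) : nat :=
  \max_(u : V) \max_(v : V)
    \max_(F : {set V} | [&& u != v, u \notin F, v \notin F & #|F| == alpha])
      dist_avoid F u v.

Definition wide_family (beta : nat) (u v : V) (k : nat) : Prop :=
  exists P : seq (seq V),
    [/\ size P = beta,
        forall p, p \in P -> is_path u v p /\ size p <= k.+1,
        uniq P &
        forall i j, i < size P -> j < size P -> i != j ->
          [disjoint interior (nth [::] P i) & interior (nth [::] P j)]].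

(* minimum over families of beta internally disjoint u-v paths of the maximum
   length of a path in the family (#|V|.+1 encodes "no such family") *)
Definition wide_dist (beta : nat) (u v : V) : nat :=
  least_upto #|V| (wide_family beta u v).

Definition wide_diam (beta : nat) : nat :=
  \max_(u : V) \max_(v : V | u != v) wide_dist beta u v.

End Graph.

Definition word (m : nat) := {ffun 'I_m -> 'I_3}.

(* x = ABCd is ((A, B), C), d) *)
Definition E3C_vertex (r s t : nat) : finType :=
  (word r * word s * word t * 'I_3)%type.

Definition hamming1 (m : nat) (X Y : word m) : bool :=
  #|[pred i | X i != Y i]| == 1.

Definition E3C_adj (r s t : nat) : rel (E3C_vertex r s t) :=
  fun x y =>
    let: (A, B, C, d) := x in
    let: (A', B', C', d') := y in
    [|| [&& A == A', B == B', C == C' & d != d'],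
        [&& nat_of_ord d == 0, nat_of_ord d' == 0, A == A', B == B' & hamming1 C C'],
        [&& nat_of_ord d == 1, nat_of_ord d' == 1, A == A', C == C' & hamming1 B B']
      | [&& nat_of_ord d == 2, nat_of_ord d' == 2, B == B', C == C' & hamming1 A A']].

(* Main.v *)
Require Import Defs.
From Stdlib Require Import ClassicalEpsilon.
From mathcomp Require Import all_boot zify.
Set Implicit Arguments. Unset Strict Implicit. Unset Printing Implicit Defensive.

(** Write a, b, c for the layers d = 2, 1, 0, in which A, B, C respectively can
be changed.

Lower bound: take u, v in layer a differing in all digits, and delete all
neighbours of u except one that gives a digit of A the value occurring in
neither u nor v.  That step is wasted, and from there on all r + s + t digits
have to be changed and the layer must be changed at least three times.

Middle inequality: 2r + 1 faults cannot meet 2r + 2 internally disjoint paths.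

Upper bound: the layers play symmetric roles, so it suffices to join
u = (A,B,C,a) to v = (A',B',C',a) or to v = (A',B',C',b), by as many disjoint
paths as twice the smallest of the three lengths, plus two.
In the first case each neighbour N of A other than A' gives a path that changes
B and C while the A-part is N and then follows, in the Hamming graph, one of the
classical disjoint paths from A to A'; two further paths change A at a
B-word B1 (resp. C-word C1) different from those of both end points.
In the second case a neighbour a of A and a neighbour b of B' are paired: the
path makes the first step to a, corrects B to b, then C, then A, and finally b
to B'; one more path changes A and B at a C-word C1 different from C and C'.
If A, A' (resp. C, C') are too close, one or two of these paths are replaced. *)

(** * Least values with a default *)

Lemma pboolP (P : Prop) : reflect P (pbool P).
Proof. by rewrite /pbool; case: excluded_middle_informative => h; constructor. Qed.

Lemma least_upto_max N P : least_upto N P <= N.+1.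
Proof. by rewrite -[X in _ <= X](size_iota 0); apply: find_size. Qed.

Lemma least_upto_spec N (P : nat -> Prop) :
  least_upto N P <= N -> P (least_upto N P).
Proof.
move=> le.
have hasP : has (fun k => pbool (P k)) (iota 0 N.+1).
  by rewrite has_find size_iota.
by have /pboolP := nth_find 0 hasP; rewrite nth_iota.
Qed.

(** For [k] beyond [N] the bound survives because the default value is N + 1. *)
Lemma least_upto_le N (P : nat -> Prop) k : P k -> least_upto N P <= k.
Proof.
move=> Pk; case: (leqP k N) => [le|lt]; last exact: leq_trans (least_upto_max N P) lt.
case: leqP => // lt; have := @before_find _ 0 (fun k => pbool (P k)) _ _ lt.
by rewrite nth_iota // add0n; move/pboolP: Pk ->.
Qed.

(** * Walks of bounded length inside a prescribed support *)

Section Walks.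
Variables (V : eqType) (e : rel V).
Implicit Types (S : V -> Prop) (x y z : V).

(** Vertices may repeat, so walks concatenate freely; they are shortened to paths only in
    [family_seq]. *)
Definition conn S L x y := exists p,
  [/\ path e x p, last x p = y, size p <= L & forall z, z \in x :: p -> S z].

Lemma conn_refl S L x : S x -> conn S L x x.
Proof. by move=> Sx; exists [::]; split=> // z; rewrite inE => /eqP->. Qed.

Lemma conn_trans S L1 L2 x y z :
  conn S L1 x y -> conn S L2 y z -> conn S (L1 + L2) x z.
Proof.
move=> [p [ep lp sp Sp]] [q [eq lq sq Sq]]; exists (p ++ q); split.
- by rewrite cat_path ep lp.
- by rewrite last_cat lp.
- by rewrite size_cat leq_add.
move=> w; rewrite -cat_cons mem_cat => /orP[/Sp //|wq].
by apply: Sq; rewrite inE wq orbT.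
Qed.

Lemma conn_step S L x y z : S x -> e x y -> conn S L y z -> conn S L.+1 x z.
Proof.
move=> Sx exy [q [eq lq sq Sq]]; exists (y :: q); split=> //=; first by rewrite exy.
by move=> w; rewrite inE => /orP[/eqP->|/Sq].
Qed.

Lemma conn_leq S L1 L2 x y : L1 <= L2 -> conn S L1 x y -> conn S L2 x y.
Proof. by move=> le [p [? ? sp ?]]; exists p; split=> //; exact: leq_trans le. Qed.

Lemma conn_end S L x y : conn S L x y -> S y.
Proof. by move=> [p [_ <- _ Sp]]; apply: Sp; apply: mem_last. Qed.

Lemma conn_sym S L x y : symmetric e -> conn S L x y -> conn S L y x.
Proof.
move=> es [p [ep <- sp Sp]]; exists (rev (belast x p)); split.
- by rewrite rev_path (eq_path (e' := e)).
- by case: p {ep sp Sp} => //= y' p; rewrite rev_cons last_rcons.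
- by rewrite size_rev size_belast.
by move=> z; rewrite -rev_rcons -lastI mem_rev; apply: Sp.
Qed.

End Walks.

Lemma conn_map (V W : eqType) (e : rel V) (e' : rel W) (f : V -> W)
    (S : V -> Prop) (T : W -> Prop) L x y :
  {homo f : a b / e a b >-> e' a b} -> (forall z, S z -> T (f z)) ->
  conn e S L x y -> conn e' T L (f x) (f y).
Proof.
move=> hf ST [p [ep <- sp Sp]]; exists (map f p); split.
- by rewrite path_map; apply: sub_path ep => a b; apply: hf.
- by rewrite last_map.
- by rewrite size_map.
by move=> w; rewrite -map_cons => /mapP[z zp ->]; apply/ST/Sp.
Qed.

(** * Families of internally disjoint paths *)

Section Families.
Variables (V : finType) (e : rel V) (u v : V).
Implicit Types (S U : V -> Prop).

(** Only the part between the two ends is constrained by [S], and [L] does not count the first and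
    last edges. *)
Definition route L S := exists x y, [/\ e u x, e y v & conn e S L x y].

(* [n] disjoint interiors of u-v paths, all contained in [U]; the interiors are
   required to be nonempty, so the edge uv (if any) is never among the paths. *)
Definition path_family L n U := exists Q : seq (seq V),
  [/\ size Q = n,
      forall q, q \in Q -> [/\ q != [::], path e u (rcons q v), uniq q,
                               size q <= L.+1 & forall z, z \in q -> U z]
    & pairwise (fun p q => [disjoint p & q]) Q].

(** Each walk is shortened within its own support, so disjointness of the interiors reduces to
    disjointness of the explicitly given sets [S j]. *)
Lemma family_seq L (J : eqType) (s : seq J) (S : J -> V -> Prop) :
  uniq s -> (forall j, j \in s -> route L (S j)) ->
  (forall i j z, i \in s -> j \in s -> S i z -> S j z -> i = j) ->
  path_family L (size s) (fun z => exists2 j, j \in s & S j z).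
Proof.
elim: s => [|j s IH] /=; first by exists [::].
move=> /andP[js us] rS dS.
have [||Q [sQ hQ dQ]] := IH us.
- by move=> i is_; apply: rS; rewrite inE is_ orbT.
- by move=> i k z is_ ks; apply: dS; rewrite inE ?is_ ?ks orbT.
have [x [y [ux yv [p [ep lp sp Sp]]]]] := rS j (mem_head _ _).
have := lp; case/shortenP: ep => p' ep' up' sub lp'.
have sS z : z \in x :: p' -> S j z.
  rewrite inE => zp; apply: Sp; rewrite inE.
  by case/orP: zp => [->//|/sub ->]; rewrite orbT.
exists ((x :: p') :: Q); split=> /=; first by rewrite sQ.
  move=> q; rewrite inE => /orP[/eqP->|qQ]; last first.
    have [-> -> -> -> Uq] := hQ q qQ; split=> // z /Uq[i is_ Si].
    by exists i => //; rewrite inE is_ orbT.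
  split=> //.
  - by rewrite /= ux rcons_path ep' lp'.
  - rewrite /= ltnS; apply: leq_trans sp; apply: uniq_leq_size sub.
    by case/andP: up'.
  by move=> z /sS Sz; exists j; rewrite ?mem_head.
rewrite dQ andbT; apply/allP => q qQ; rewrite disjoint_has; apply/hasPn => z zp.
apply/negP => /= zq; have [_ _ _ _ /(_ z zq)[i is_ Si]] := hQ q qQ.
move: js; rewrite (dS j i z) ?is_ // ?mem_head //; last exact: sS.
by rewrite inE is_ orbT.
Qed.

Lemma family1 L S : route L S -> path_family L 1 S.
Proof.
move=> rS; have [//|//|[] [] //|Q [sQ hQ dQ]] := @family_seq L _ [:: tt] (fun=> S).
by exists Q; split=> // q /hQ[-> -> -> -> Uq]; split=> // z /Uq[].
Qed.

Lemma family_cat L n1 n2 U1 U2 :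
  path_family L n1 U1 -> path_family L n2 U2 -> (forall z, U1 z -> U2 z -> False) ->
  path_family L (n1 + n2) (fun z => U1 z \/ U2 z).
Proof.
move=> [Q1 [<- h1 d1]] [Q2 [<- h2 d2]] dis; exists (Q1 ++ Q2); split.
- by rewrite size_cat.
- move=> q; rewrite mem_cat => /orP[/h1|/h2] [-> -> -> -> Uq].
    by split=> // z /Uq; left.
  by split=> // z /Uq; right.
rewrite pairwise_cat d1 d2 !andbT; apply/allrelP => p q pQ qQ.
rewrite disjoint_has; apply/hasPn => z zp; apply/negP => /= zq.
have [_ _ _ _ /(_ z zp) U1z] := h1 p pQ.
have [_ _ _ _ /(_ z zq) U2z] := h2 q qQ.
exact: dis U1z U2z.
Qed.

(** An interior with at most L + 1 vertices, closed up by u and v, gives a path of length at most L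
    + 2. *)
Lemma wide_interiors L (Q : seq (seq V)) : u != v -> uniq Q ->
  (forall q, q \in Q -> [/\ path e u (rcons q v), uniq q, u \notin q, v \notin q
                          & size q <= L.+1]) ->
  pairwise (fun p q => [disjoint p & q]) Q ->
  wide_family e (size Q) u v L.+2.
Proof.
move=> uv uQ hQ dQ; exists [seq u :: rcons q v | q <- Q]; split.
- by rewrite size_map.
- move=> p /mapP[q /hQ[pq uq unq vnq sq] ->]; split; last by rewrite /= size_rcons.
  split=> //; first by rewrite /= last_rcons.
  by rewrite /= mem_rcons inE negb_or uv unq rcons_uniq vnq uq.
- by rewrite map_inj_uniq // => p q [] /rcons_inj[].
have intE q : interior (u :: rcons q v) = q.
  by rewrite /interior /= size_rcons subSS subSS subn0 -cats1 take_size_cat.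
rewrite size_map => i j iQ jQ ij; rewrite !(nth_map [::]) // !intE.
have {}dQ := elimT (pairwiseP [::]) dQ.
case: (ltngtP i j) ij => // ij _; first exact: dQ.
by rewrite disjoint_sym; apply: dQ.
Qed.

Lemma wide_family_leq n m L : m <= n ->
  wide_family e n u v L -> wide_family e m u v L.
Proof.
move=> mn [P [sP hP uP dP]]; exists (take m P).
have st : size (take m P) = m by rewrite size_takel // sP.
split=> //; first by move=> p /mem_take /hP.
  exact: take_uniq.
rewrite st => i j im jm ij; rewrite !nth_take //.
by apply: dP; rewrite ?sP //; apply: leq_trans mn.
Qed.

(** A nonempty list is not disjoint from itself, so disjoint nonempty interiors are distinct. *)
Lemma family_uniq L U Q :
  (forall q, q \in Q -> [/\ q != [::], path e u (rcons q v), uniq q,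
                               size q <= L.+1 & forall z, z \in q -> U z]) ->
  pairwise (fun p q : seq V => [disjoint p & q]) Q -> uniq Q.
Proof.
move=> hQ; rewrite uniq_pairwise.
apply: (@sub_in_pairwise _ (mem Q)); last exact/allP.
by move=> p q /hQ[]; case: p => // a p _ _ _ _ _ _; apply: contraTneq => <-; rewrite disjoint_has /= mem_head.
Qed.

Lemma family_wide L n U : u != v -> ~ U u -> ~ U v ->
  path_family L n U -> wide_family e n u v L.+2.
Proof.
move=> uv nu nv [Q [<- hQ dQ]]; apply: wide_interiors => //.
  exact: family_uniq hQ dQ.
by move=> q /hQ[_ -> -> -> Uq]; split=> //; apply/negP => /Uq.
Qed.

(** The edge uv joins the family as the path with empty interior; it is new because the other
    interiors are nonempty. *)
Lemma family_wide_edge L n U : u != v -> e u v -> ~ U u -> ~ U v ->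
  path_family L n U -> wide_family e n.+1 u v L.+2.
Proof.
move=> uv euv nu nv [Q [<- hQ dQ]].
apply: (@wide_interiors L ([::] :: Q)) => //.
- rewrite /= (family_uniq hQ dQ) // andbT.
  by apply/negP => /hQ[].
- move=> q; rewrite inE => /orP[/eqP->|/hQ[_ -> -> -> Uq]]; first by rewrite /= euv.
  by split=> //; apply/negP => /Uq.
rewrite /= dQ andbT; apply/allP => q _; by rewrite disjoint_has.
Qed.

End Families.

Lemma wide_family_map (V W : finType) (e : rel V) (e' : rel W) (f : V -> W) n u v L :
  injective f -> {homo f : a b / e a b >-> e' a b} ->
  wide_family e n u v L -> wide_family e' n (f u) (f v) L.
Proof.
move=> fi hf [P [sP hP uP dP]]; exists (map (map f) P); split.
- by rewrite size_map.
- move=> _ /mapP[p /hP[[hp sp lp pp up] sL] ->]; rewrite size_map; split=> //.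
  split; rewrite ?size_map ?map_inj_uniq //.
  + by case: p hp {sp lp pp up sL} => //= a p ->.
  + by rewrite last_map lp.
  by rewrite behead_map path_map; apply: sub_path pp => a b; apply: hf.
- by rewrite map_inj_uniq //; apply: inj_map.
rewrite size_map => i j iP jP ij; rewrite !(nth_map [::]) //.
have intE p : interior (map f p) = map f (interior p).
  by rewrite /interior size_map behead_map map_take.
rewrite !intE disjoint_has; apply/hasPn => _ /mapP[x xi ->] /=.
rewrite mem_map //; have := dP i j iP jP ij.
by rewrite disjoint_has => /hasPn/(_ x xi).
Qed.

(** * The fault diameter is at most the wide diameter *)

Lemma fault_le_wide (V : finType) (e : rel V) k :
  fault_diam e k <= wide_diam e k.+1.
Proof.
apply/bigmax_leqP => u _; apply/bigmax_leqP => v _; apply/bigmax_leqP => F.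
case/and4P => uv uF vF /eqP cF.
rewrite /wide_diam (leq_trans _ (leq_bigmax u)) //.
rewrite (leq_trans _ (leq_bigmax_cond v uv)) //.
(* If no wide family exists, the right-hand side is the largest value that [least_upto] can take. *)
case: (leqP (wide_dist e k.+1 u v) #|V|) => [|lt]; last first.
  exact: leq_trans (least_upto_max _ _) lt.
move=> /least_upto_spec; rewrite -/(wide_dist _ _ _ _).
move: (wide_dist _ _ _ _) => w [P [sP hP uP dP]].
(* Some path avoids F: otherwise each path has a fault, in its interior since u and v are not in F,
   and choosing one per path injects k + 1 indices into the k faults. *)
have [p pP pF] : exists2 p, p \in P & all (fun x => x \notin F) p.
  apply/hasP; apply/negPn/negP => /hasPn hF.
  have hx (i : 'I_k.+1) : exists x, (x \in interior (nth [::] P i)) && (x \in F).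
    have iP : i < size P by rewrite sP.
    have [[hp sp lp _ up] _] := hP _ (mem_nth [::] iP).
    have /allPn[x xp /negPn xF] := hF _ (mem_nth [::] iP).
    exists x; rewrite xF andbT; move: hp sp lp up xp.
    case: (nth _ _ _) => //= a q -> _; case/lastP: q => [|q b].
      by rewrite /= inE => -> _ /eqP xu; move: xF; rewrite xu (negPf vF).
    rewrite last_rcons => -> _; rewrite /interior /= size_rcons subSS subSS subn0.
    rewrite -cats1 take_size_cat // inE mem_cat inE.
    case/or3P => // /eqP xe; move: xF; rewrite xe ?(negPf uF) ?(negPf vF) //.
  pose g i := xchoose (hx i).
  have gi : injective g.
    move=> i j gij; apply/eqP; apply/negPn/negP => ij.
    have /andP[xi _] := xchooseP (hx i); have /andP[xj _] := xchooseP (hx j).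
    have := dP i j; rewrite sP !ltn_ord => /(_ isT isT ij).
    rewrite disjoint_has => /hasPn/(_ _ xi) /=.
    by rewrite -/(g i) gij xj.
  have : #|[set g i | i : 'I_k.+1]| <= #|F|.
    apply: subset_leq_card; apply/subsetP => _ /imsetP[i _ ->].
    by have /andP[] := xchooseP (hx i).
  by rewrite card_imset // card_ord cF ltnn.
have [pth sp] := hP p pP.
have [_ sp0 _ _ _] := pth.
apply: leq_trans (_ : (size p).-1 <= w); last by rewrite -ltnS prednK.
by apply: least_upto_le; exists p; rewrite prednK.
Qed.

(** * Words and the Hamming graph *)

Lemma third_digit (a b : 'I_3) : exists c, (c != a) && (c != b).
Proof.
apply/existsP; case: (pickP [pred c | (c != a) && (c != b)]) => [c h|h].
  by apply/existsP; exists c.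
have : #|[set: 'I_3]| <= #|[set a; b]|.
  apply: subset_leq_card; apply/subsetP => c _; rewrite !inE.
  by move: (h c) => /=; case: eqP => //= _; case: eqP.
by rewrite cardsT card_ord cards2; case: (_ != _).
Qed.

Definition shift (a : 'I_3) (b : bool) : 'I_3 := Ordinal (ltn_pmod (a + b.+1) (isT : 0 < 3)).

Lemma shift_neq a b : shift a b != a.
Proof. by rewrite -val_eqE /=; case: a b => [[|[|[|//]]] ?] []. Qed.

Lemma shift_inj a : injective (shift a).
Proof. by move=> b c /(congr1 val) /=; case: a b c => [[|[|[|//]]] ?] [] []. Qed.

Lemma shift_surj a x : x != a -> exists b, x = shift a b.
Proof.
move=> xa.
have : (x == shift a false) || (x == shift a true).
  move: xa; rewrite -!val_eqE /=.
  by case: a x => [[|[|[|//]]] ?] [[|[|[|//]]] ?].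
by case/orP => /eqP->; [exists false|exists true].
Qed.

Section Words.
Variable m : nat.
Implicit Types X Y Z W : word m.

Definition hdist X Y := #|[pred i | X i != Y i]|.

Definition upd X i x : word m := [ffun k => if k == i then x else X k].

Lemma upd_same X i x : upd X i x i = x.
Proof. by rewrite ffunE eqxx. Qed.

Lemma upd_other X i x k : k != i -> upd X i x k = X k.
Proof. by rewrite ffunE => /negPf->. Qed.

Lemma hdist_le X Y : hdist X Y <= m.
Proof. by rewrite -[X in _ <= X](card_ord m); apply: max_card. Qed.

Lemma hdist_sym X Y : hdist X Y = hdist Y X.
Proof. by apply: eq_card => i; rewrite !inE eq_sym. Qed.

Lemma hdist_xx X : hdist X X = 0.
Proof. by apply/eqP/pred0P => i; rewrite /= eqxx. Qed.

Lemma hamming1_sym : symmetric (@hamming1 m).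
Proof. by move=> X Y; rewrite /hamming1 -!/(hdist _ _) hdist_sym. Qed.

Lemma hamming1_upd X i x : x != X i -> hamming1 X (upd X i x).
Proof.
move=> xi; apply/eqP; rewrite -[RHS](card1 i); apply: eq_card => k; rewrite !inE ffunE.
by case: (eqVneq k i) => [->|_]; rewrite ?eqxx // eq_sym xi.
Qed.

Lemma hamming1P X Y : hamming1 X Y -> exists2 i, Y i != X i & Y = upd X i (Y i).
Proof.
move=> /eqP /mem_card1[i hi]; exists i; first by have := hi i; rewrite !inE eqxx eq_sym.
apply/ffunP => k; rewrite ffunE; case: (eqVneq k i) => [->//|ki].
by have := hi k; rewrite !inE (negPf ki) => /negbFE/eqP.
Qed.

Lemma hamming1_irr X : ~~ hamming1 X X.
Proof. by rewrite /hamming1 -/(hdist X X) hdist_xx. Qed.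

Lemma neq_word X Y : X != Y -> exists i, X i != Y i.
Proof.
move=> XY; apply/existsP; apply: contraR XY => /existsPn h.
by apply/eqP/ffunP => i; apply/eqP/negPn.
Qed.

Lemma hdist_upd X Y i : X i != Y i -> hdist X Y = (hdist (upd X i (Y i)) Y).+1.
Proof.
move=> h; rewrite /hdist (cardD1 i) inE h; congr _.+1; apply: eq_card => k.
by rewrite !inE ffunE; case: (eqVneq k i) => [->|//]; rewrite eqxx.
Qed.

Lemma hdist_hamming1 X Z Y : hamming1 X Z -> hdist X Y <= (hdist Z Y).+1.
Proof.
move=> /hamming1P[i _ ->]; rewrite -[X in _ <= X]add1n /hdist (cardD1 i).
apply: leq_add; first by case: (_ \in _).
apply: subset_leq_card; apply/subsetP => k; rewrite !inE ffunE.
by case: eqP.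
Qed.

(** Wrong digits are corrected one at a time, so no digit foreign to both ends ever appears. *)
Lemma conn_box X Y :
  conn (@hamming1 m) (fun Z => forall k, Z k = X k \/ Z k = Y k) (hdist X Y) X Y.
Proof.
move eL : (hdist X Y) => L; elim: L X eL => [|L IH] X eL.
  have -> : X = Y; last by apply: conn_refl; left.
  apply/ffunP => i; apply/eqP/negPn/negP => h.
  by have := hdist_upd h; rewrite eL.
have [i h] : exists i, X i != Y i.
  by apply: neq_word; apply: contra_eq_neq eL => ->; rewrite hdist_xx.
apply: (@conn_step _ _ _ _ _ (upd X i (Y i))); first by left.
  by rewrite hamming1_upd // eq_sym.
have eL' : hdist (upd X i (Y i)) Y = L by apply: succn_inj; rewrite -hdist_upd.
have := IH _ eL'; apply: (@conn_map _ _ _ _ id) => // Z hZ k.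
by case: (hZ k) => ->; [rewrite ffunE; case: eqP => [->|]|]; auto.
Qed.

Lemma conn_word (T : word m -> Prop) X Y :
  (forall Z, T Z) -> conn (@hamming1 m) T m X Y.
Proof.
move=> hT; apply: conn_leq (hdist_le X Y) _.
by apply: (@conn_map _ _ _ _ id) (conn_box X Y).
Qed.

(** The 2m neighbours of a word are indexed by a position and a choice between the two other digits
    there. *)
Definition nbr X (j : 'I_m * bool) := upd X j.1 (shift (X j.1) j.2).

Lemma hamming1_nbr X j : hamming1 X (nbr X j).
Proof. by rewrite hamming1_upd // shift_neq. Qed.

Lemma nbr_inj X : injective (nbr X).
Proof.
move=> [i a] [j b] /= E.
have ij : i = j.
  apply/eqP/negPn/negP => ij; have := congr1 (fun f : word m => f i) E.
  by rewrite /nbr /= upd_same upd_other // => /eqP; rewrite (negPf (shift_neq _ _)).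
rewrite -ij in E *; congr pair; apply: (@shift_inj (X i)).
by have := congr1 (fun f : word m => f i) E; rewrite /nbr /= !upd_same.
Qed.

Lemma nbrP X Y : hamming1 X Y -> exists j, Y = nbr X j.
Proof.
move=> /hamming1P[i h ->]; have [b ->] := shift_surj h.
by exists (i, b).
Qed.

Definition nbrs X := [seq nbr X j | j : 'I_m * bool].

Lemma mem_nbrs X Y : (Y \in nbrs X) = hamming1 X Y.
Proof.
apply/imageP/idP => [[j _ ->]|/nbrP[j ->]]; first exact: hamming1_nbr.
by exists j.
Qed.

Lemma nbrs_uniq X : uniq (nbrs X).
Proof. by rewrite map_inj_uniq ?enum_uniq //; apply: nbr_inj. Qed.

Lemma size_nbrs X : size (nbrs X) = 2 * m.
Proof. by rewrite size_map -cardE card_prod card_ord card_bool mulnC. Qed.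

Lemma third_word X Y : 0 < m -> exists M : word m, [/\ M <> X, M <> Y & hdist X M <= 1].
Proof.
move=> m0; pose i := Ordinal m0; have [c /andP[cX cY]] := third_digit (X i) (Y i).
have h := hamming1_upd cX; exists (upd X i c); split.
- by move/(congr1 (fun W : word m => W i))/eqP; rewrite upd_same (negPf cX).
- by move/(congr1 (fun W : word m => W i))/eqP; rewrite upd_same (negPf cY).
by rewrite /hdist (eqP h).
Qed.

(** This is k - i modulo m, the rank of [k] in the cyclic order starting at [i]. *)
Definition offset (i k : 'I_m) := if i <= k then k - i else k + m - i.

Lemma offset_inj i : injective (offset i).
Proof.
move=> j k; rewrite /offset => E; apply: val_inj => /=.
by move: E (ltn_ord i) (ltn_ord j) (ltn_ord k); do 2 case: ifP; lia.
Qed.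

(** The two inequalities say that i, j, k, respectively j, i, k, occur in this cyclic order, and
    these orders are opposite. *)
Lemma offset_cycle i j k :
  i != j -> offset i j < offset i k -> offset j i < offset j k -> False.
Proof.
rewrite -val_eqE /= /offset.
move: (ltn_ord i) (ltn_ord j) (ltn_ord k).
by case: (leqP i j) => ?; case: (leqP j i) => ?; case: (leqP i k) => ?;
  case: (leqP j k) => ?; lia.
Qed.

(* The interior of the path from [X] to [Y] that leaves [X] through
   [upd X i x].  If [x] is not the digit of [Y], digit [i] is corrected last;
   otherwise the digits are corrected in the cyclic order starting at [i]. *)
Definition fan_set X Y i (x : 'I_3) Z : Prop :=
  [/\ Z i = x, (forall k, k != i -> Z k = X k \/ Z k = Y k), Z != Y
    & x = Y i -> forall p k, X p != Y p -> Z p = Y p -> Z k != Y k ->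
                 offset i p < offset i k].

(** Suppose i differs from j. The foreign digit that each set forces must, by the box condition of
    the other, be the digit of [Y], so both sets are of the cyclic kind. A position where [Z] is
    still wrong then comes after [j] when counting from [i] and after [i] when counting from [j],
    against [offset_cycle]. *)
Lemma fan_set_disjoint X Y i x j y Z : x != X i -> y != X j ->
  fan_set X Y i x Z -> fan_set X Y j y Z -> i = j /\ x = y.
Proof.
move=> xi yj [Zi boxi ZY oi] [Zj boxj _ oj].
case: (eqVneq i j) => [ij|ij]; first by rewrite -ij in Zj; rewrite -Zi -Zj.
exfalso.
have Zi' : Z i = Y i.
  by case: (boxj i ij) => // E; move: xi; rewrite -Zi E eqxx.
have Zj' : Z j = Y j.
  by rewrite eq_sym in ij; case: (boxi j ij) => // E; move: yj; rewrite -Zj E eqxx.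
have [k Zk] := neq_word ZY.
apply: (@offset_cycle i j k) => //.
  by apply: oi; rewrite // -?Zi // -Zj' Zj eq_sym.
by apply: oj; rewrite // -?Zj // -Zi' Zi eq_sym.
Qed.

(** Repeatedly correct the wrong position of least offset from [i], and stop at the last word before
    [Y]. *)
Lemma fan_rotation X Y i : X i != Y i -> forall Z, fan_set X Y i (Y i) Z ->
  exists2 W, hamming1 W Y & conn (@hamming1 m) (fan_set X Y i (Y i)) (hdist Z Y) Z W.
Proof.
move=> XYi Z; move eL : (hdist Z Y) => L; elim: L Z eL => [|L IH] Z eL fZ.
  by have [_ _ /neq_word[k /hdist_upd]] := fZ; rewrite eL.
have [Zi box ZY oZ] := fZ.
have [k0 hk0] := neq_word ZY.
have [k Zk mink] := arg_minnP (offset i) (hk0 : (fun k => Z k != Y k) k0).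
have eL' : hdist (upd Z k (Y k)) Y = L by apply: succn_inj; rewrite -hdist_upd.
have hZ : hamming1 Z (upd Z k (Y k)) by rewrite hamming1_upd // eq_sym.
case: (eqVneq (upd Z k (Y k)) Y) => [E|NE].
  by exists Z; [rewrite -[X in hamming1 _ X]E|apply: conn_refl].
have ki : k != i by apply: contraNneq Zk => ->; rewrite Zi.
have [|W WY cW] := IH _ eL'; last by exists W => //; apply: conn_step cW.
split=> //.
- by rewrite upd_other // eq_sym.
- by move=> l li; rewrite ffunE; case: eqP => [->|_]; [right|apply: box].
move=> _ p l Xp Zp Zl.
have lk : l != k by apply: contraNneq Zl => ->; rewrite upd_same.
rewrite upd_other // in Zl.
case: (eqVneq p k) => [->|pk]; last by apply: oZ => //; rewrite -Zp upd_other.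
by rewrite ltn_neqAle mink // andbT (inj_eq (@offset_inj i)) eq_sym.
Qed.

Lemma fan_path X Y i x : x != X i -> upd X i x != Y ->
  exists2 W, hamming1 W Y & conn (@hamming1 m) (fan_set X Y i x) m (upd X i x) W.
Proof.
move=> xi NY; case: (eqVneq x (Y i)) => [xY|xY].
  have [||W WY cW] := @fan_rotation X Y i _ (upd X i x).
  - by rewrite -xY eq_sym.
  - split=> //; rewrite ?upd_same //.
    + by move=> k ki; left; rewrite upd_other.
    move=> _ p k Xp; case: (eqVneq p i) => [-> _|pi].
      rewrite {1}/offset leqnn subnn => Zk; rewrite lt0n.
      have ki : k != i by apply: contraNneq Zk => ->; rewrite upd_same xY.
      apply: contra_neqN ki => E; apply: (@offset_inj i); rewrite (eqP E).
      by rewrite /offset leqnn subnn.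
    by rewrite upd_other // => E; rewrite E eqxx in Xp.
  by exists W => //; rewrite xY in cW *; apply: conn_leq cW; apply: hdist_le.
(* Here digit [i] stays wrong on the whole box, so the walk cannot meet [Y] before its last edge. *)
exists (upd Y i x); first by rewrite hamming1_sym hamming1_upd.
apply: conn_leq (hdist_le (upd X i x) (upd Y i x)) _.
apply: (@conn_map _ _ _ _ id) (conn_box _ _) => // Z hZ.
have Zi : Z i = x by case: (hZ i); rewrite upd_same.
split=> //.
- by move=> k ki; case: (hZ k); rewrite upd_other //; auto.
- by apply: contraNneq xY => <-; rewrite Zi.
by move=> E; rewrite E eqxx in xY.
Qed.

End Words.

Lemma family_sub (V : finType) (e : rel V) u v L n (U1 U2 : V -> Prop) :
  (forall z, U1 z -> U2 z) -> path_family e u v L n U1 -> path_family e u v L n U2.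
Proof.
move=> h [Q [sQ hQ dQ]]; exists Q; split=> // q /hQ[-> -> -> -> Uq].
by split=> // z /Uq/h.
Qed.

Lemma mem_zip_split (T1 T2 : eqType) (a : seq T1) (b : seq T2) p :
  p \in zip a b -> p.1 \in a /\ p.2 \in b.
Proof.
elim: a b => [|x a IH] [|y b] //=; rewrite !inE => /orP[/eqP->/=|/IH[-> ->]].
  by rewrite !eqxx.
by rewrite !orbT.
Qed.

(** Zipping duplicate-free lists yields a matching: a pair is determined by either component. *)
Lemma zip_uniq_eq (T1 T2 : eqType) (a : seq T1) (b : seq T2) p q :
  uniq a -> uniq b -> p \in zip a b -> q \in zip a b ->
  p.1 = q.1 \/ p.2 = q.2 -> p = q.
Proof.
elim: a b => [|x a IH] [|y b] //= /andP[xa ua] /andP[yb ub].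
rewrite !inE => /orP[/eqP->|pz] /orP[/eqP->|qz] //=.
- by have [h1 h2] := mem_zip_split qz; case=> E; rewrite E ?h1 ?h2 in xa yb.
- by have [h1 h2] := mem_zip_split pz; case=> E; rewrite -E ?h1 ?h2 in xa yb.
exact: (IH b).
Qed.

Lemma zip_uniq_pair (T1 T2 : eqType) (a : seq T1) (b : seq T2) :
  uniq a -> uniq (zip a b).
Proof.
elim: a b => [|x a IH] [|y b] //= /andP[xa ua]; rewrite IH // andbT.
by apply: contra xa => /mem_zip_split[].
Qed.

(** * Walks in the exchanged 3-ary cube *)

Definition dig0 : 'I_3 := @Ordinal 3 0 isT.
Definition dig1 : 'I_3 := @Ordinal 3 1 isT.
Definition dig2 : 'I_3 := @Ordinal 3 2 isT.

Section Cube.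
Variables r s t : nat.
Notation V := (E3C_vertex r s t).
Notation e := (@E3C_adj r s t).
Implicit Types (A X : word r) (B Y : word s) (C Z : word t) (S : V -> Prop).

(* The three vertices over ABC; moves in [va], [vb], [vc] change A, B, C. *)
Definition va A B C : V := (A, B, C, dig2).
Definition vb A B C : V := (A, B, C, dig1).
Definition vc A B C : V := (A, B, C, dig0).

(** Supports are described layer by layer, so that disjointness splits into three elementary checks
    on words. *)
Definition layers (Pa Pb Pc : word r -> word s -> word t -> Prop) (w : V) : Prop :=
  let: (X, Y, Z, d) := w in
  match nat_of_ord d with 0 => Pc X Y Z | 1 => Pb X Y Z | _ => Pa X Y Z end.

Lemma adj_digit A B C d d' : d != d' -> e (A, B, C, d) (A, B, C, d').
Proof. by move=> h; rewrite /= !eqxx h. Qed.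

Lemma adj_a A A' B C : hamming1 A A' -> e (va A B C) (va A' B C).
Proof. by move=> h; rewrite /= !eqxx h !orbT. Qed.

Lemma adj_b A B B' C : hamming1 B B' -> e (vb A B C) (vb A B' C).
Proof. by move=> h; rewrite /= !eqxx h !orbT. Qed.

Lemma adj_c A B C C' : hamming1 C C' -> e (vc A B C) (vc A B C').
Proof. by move=> h; rewrite /= !eqxx h !orbT. Qed.

Lemma conn_a_in (T : word r -> Prop) L A A' B C S :
  conn (@hamming1 r) T L A A' -> (forall X, T X -> S (va X B C)) ->
  conn e S L (va A B C) (va A' B C).
Proof.
move=> cT TS; apply: (conn_map (f := fun X => va X B C)) cT => //.
by move=> X Y; apply: adj_a.
Qed.

Lemma conn_b_in (T : word s -> Prop) L A B B' C S :
  conn (@hamming1 s) T L B B' -> (forall Y, T Y -> S (vb A Y C)) ->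
  conn e S L (vb A B C) (vb A B' C).
Proof.
move=> cT TS; apply: (conn_map (f := fun Y => vb A Y C)) cT => //.
by move=> X Y; apply: adj_b.
Qed.

Lemma conn_c_in (T : word t -> Prop) L A B C C' S :
  conn (@hamming1 t) T L C C' -> (forall Z, T Z -> S (vc A B Z)) ->
  conn e S L (vc A B C) (vc A B C').
Proof.
move=> cT TS; apply: (conn_map (f := fun Z => vc A B Z)) cT => //.
by move=> X Y; apply: adj_c.
Qed.

Lemma conn_a A A' B C S : (forall X, S (va X B C)) ->
  conn e S r (va A B C) (va A' B C).
Proof. by move=> h; apply: (conn_a_in (T := fun=> True)) => //; apply: conn_word. Qed.

Lemma conn_b A B B' C S : (forall Y, S (vb A Y C)) ->
  conn e S s (vb A B C) (vb A B' C).
Proof. by move=> h; apply: (conn_b_in (T := fun=> True)) => //; apply: conn_word. Qed.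

Lemma conn_c A B C C' S : (forall Z, S (vc A B Z)) ->
  conn e S t (vc A B C) (vc A B C').
Proof. by move=> h; apply: (conn_c_in (T := fun=> True)) => //; apply: conn_word. Qed.

Lemma conn_b1 A B B' C S : hdist B B' <= 1 -> (forall Y, S (vb A Y C)) ->
  conn e S 1 (vb A B C) (vb A B' C).
Proof. by move=> h hS; apply: conn_leq h (conn_b_in (conn_box B B') _). Qed.

Lemma conn_c1 A B C C' S : hdist C C' <= 1 -> (forall Z, S (vc A B Z)) ->
  conn e S 1 (vc A B C) (vc A B C').
Proof. by move=> h hS; apply: conn_leq h (conn_c_in (conn_box C C') _). Qed.

Notation L := (r + s + t + 4).

Lemma route_b A B C A' B' C' B1 : hdist B B1 <= 1 ->
  route e (va A B C) (va A' B' C') L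
    (layers (fun _ Y Z => Y = B1 /\ Z = C)
            (fun X _ Z => (X = A /\ Z = C) \/ (X = A' /\ Z = C'))
            (fun X Y _ => X = A' /\ Y = B1)).
Proof.
move=> h; exists (vb A B C), (vb A' B' C'); split; try exact: adj_digit.
set S := layers _ _ _.
(* The bound [L] is attained here: one step to [B1], then r + t + s digit changes and three changes
   of layer. The two end edges make it r + s + t + 6. *)
apply: (@conn_leq _ _ _ (1 + (r + (t + s.+1).+1).+1)); first lia.
apply: conn_trans (conn_b1 h _) _; first by move=> Y; left.
apply: (@conn_step _ _ _ _ _ (va A B1 C)); [by left|exact: adj_digit|].
apply: conn_trans (conn_a A A' _) _; first by [].
apply: (@conn_step _ _ _ _ _ (vc A' B1 C)); [by []|exact: adj_digit|].
apply: conn_trans (conn_c C C' _) _; first by [].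
apply: (@conn_step _ _ _ _ _ (vb A' B1 C')); [by []|exact: adj_digit|].
by apply: conn_b => Y; right.
Qed.

Lemma route_c A B C A' B' C' C1 v : hdist C C1 <= 1 -> e (vc A' B' C') v ->
  route e (va A B C) v L
    (layers (fun _ Y Z => Y = B /\ Z = C1)
            (fun X _ Z => X = A' /\ Z = C1)
            (fun X Y _ => (X = A /\ Y = B) \/ (X = A' /\ Y = B'))).
Proof.
move=> h ev; exists (vc A B C), (vc A' B' C'); split=> //; try exact: adj_digit.
set S := layers _ _ _.
apply: (@conn_leq _ _ _ (1 + (r + (s + t.+1).+1).+1)); first lia.
apply: conn_trans (conn_c1 h _) _; first by move=> Y; left.
apply: (@conn_step _ _ _ _ _ (va A B C1)); [by left|exact: adj_digit|].
apply: conn_trans (conn_a A A' _) _; first by [].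
apply: (@conn_step _ _ _ _ _ (vb A' B C1)); [by []|exact: adj_digit|].
apply: conn_trans (conn_b B B' _) _; first by [].
apply: (@conn_step _ _ _ _ _ (vc A' B' C1)); [by []|exact: adj_digit|].
by apply: conn_c => Y; right.
Qed.

(** When A and A' are adjacent, the fan has only 2r - 1 paths. This route and the next, which change
    A only in their last, respectively first, edge, replace the missing path and [route_c], whose
    support they meet. *)
Lemma route_keep_A A B C A' B' C' : hamming1 A A' ->
  route e (va A B C) (va A' B' C') L
    (layers (fun X Y Z => [/\ X = A, Y = B' & Z = C'])
            (fun X _ Z => X = A /\ Z = C')
            (fun X Y _ => X = A /\ Y = B)).
Proof.
move=> h; exists (vc A B C), (va A B' C'); split.
- exact: adj_digit.
- exact: adj_a.
set S := layers _ _ _.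
apply: (@conn_leq _ _ _ (t + (s + 1).+1)); first lia.
apply: conn_trans (conn_c C C' _) _; first by [].
apply: (@conn_step _ _ _ _ _ (vb A B C')); [by []|exact: adj_digit|].
apply: conn_trans (conn_b B B' _) _; first by [].
apply: (@conn_step _ _ _ _ _ (va A B' C')); [by []|exact: adj_digit|].
exact: conn_refl.
Qed.

Lemma route_keep_A' A B C A' B' C' : hamming1 A A' ->
  route e (va A B C) (va A' B' C') L
    (layers (fun X Y Z => [/\ X = A', Y = B & Z = C])
            (fun X _ Z => X = A' /\ Z = C)
            (fun X Y _ => X = A' /\ Y = B')).
Proof.
move=> h; exists (va A' B C), (vc A' B' C'); split.
- exact: adj_a.
- exact: adj_digit.
set S := layers _ _ _.
apply: (@conn_leq _ _ _ (s + t.+1).+1); first lia.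
apply: (@conn_step _ _ _ _ _ (vb A' B C)); [by []|exact: adj_digit|].
apply: conn_trans (conn_b B B' _) _; first by [].
apply: (@conn_step _ _ _ _ _ (vc A' B' C)); [by []|exact: adj_digit|].
exact: conn_c.
Qed.

Lemma route_fan A B C A' B' C' i x : x != A i -> upd A i x != A' ->
  route e (va A B C) (va A' B' C') L
    (layers (fun X Y Z => fan_set A A' i x X /\
                          ((Y = B /\ Z = C) \/ (Y = B' /\ Z = C')))
            (fun X _ Z => fan_set A A' i x X /\ Z = C)
            (fun X Y _ => fan_set A A' i x X /\ Y = B')).
Proof.
move=> xi NA'; have [W WA' cW] := fan_path xi NA'.
have fN : fan_set A A' i x (upd A i x).
  by case: cW => p [_ _ _]; apply; rewrite mem_head.
set N := upd A i x in NA' cW fN *.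
exists (va N B C), (va W B' C'); split; try by apply: adj_a => //; apply: hamming1_upd.
set S := layers _ _ _.
apply: (@conn_leq _ _ _ (s + (t + r.+1).+1).+1); first lia.
apply: (@conn_step _ _ _ _ _ (vb N B C)); [by split; [|left]|exact: adj_digit|].
apply: conn_trans (conn_b B B' _) _; first by [].
apply: (@conn_step _ _ _ _ _ (vc N B' C)); [by []|exact: adj_digit|].
apply: conn_trans (conn_c C C' _) _; first by [].
apply: (@conn_step _ _ _ _ _ (va N B' C')); [by []|exact: adj_digit|].
by apply: conn_a_in cW _ => X fX; split=> //; right.
Qed.

Lemma family_fan A B C A' B' C' :
  path_family e (va A B C) (va A' B' C') L (2 * r - hamming1 A A')
    (layers (fun X Y Z => [/\ X <> A, X <> A' &
                           (Y = B /\ Z = C) \/ (Y = B' /\ Z = C')])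
            (fun X _ Z => [/\ X <> A, X <> A' & Z = C])
            (fun X Y _ => [/\ X <> A, X <> A' & Y = B'])).
Proof.
(* The neighbour A' is left out: a fan set excludes its target. This accounts for the subtracted
   boolean. *)
pose js := [seq j <- enum {: 'I_r * bool} | nbr A j != A'].
have sz : size js = 2 * r - hamming1 A A'.
  have /(congr1 size) : map (nbr A) js = rem A' (nbrs A).
    by rewrite rem_filter ?nbrs_uniq // /nbrs /image_mem filter_map.
  rewrite size_map => ->.
  case: (boolP (hamming1 A A')); rewrite -mem_nbrs => h.
    by rewrite size_rem // size_nbrs subn1.
  by rewrite rem_id // size_nbrs subn0.
pose fs (j : 'I_r * bool) := fan_set A A' j.1 (shift (A j.1) j.2).
have fsN j X : fs j X -> X <> A /\ X <> A'.
  move=> [Xi _ /eqP XA' _]; split=> // E; rewrite E in Xi.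
  by have := shift_neq (A j.1) j.2; rewrite -Xi eqxx.
rewrite -sz; pose S j := layers
  (fun X Y Z => fs j X /\ ((Y = B /\ Z = C) \/ (Y = B' /\ Z = C')))
  (fun X _ Z => fs j X /\ Z = C) (fun X Y _ => fs j X /\ Y = B').
apply: family_sub (family_seq (S := S) _ _ _).
- case=> [[[X Y] Z] [[|[|[|//]]] ?]] /= [j _ [/fsN]] [h1 h2] h3; by split.
- by rewrite filter_uniq // enum_uniq.
- move=> j; rewrite mem_filter => /andP[h _].
  by apply: route_fan => //; apply: shift_neq.
move=> i j z _ _ Si Sj.
(* In every layer the A-part of a common vertex would lie in both fan sets. *)
have : exists X, fs i X /\ fs j X.
  move: z Si Sj; case=> [[[X Y] Z] [[|[|[|//]]] ?]] /= [h _] [h' _]; by exists X.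
case=> X [/fan_set_disjoint d /d[]]; try exact: shift_neq.
case: i {Si d} => i b; case: j {Sj} => j b' /= -> /shift_inj E.
by rewrite E.
Qed.

End Cube.

(** * Exchanging the roles of the layers *)

Definition exch01 (d : 'I_3) := match nat_of_ord d with 0 => dig1 | 1 => dig0 | _ => dig2 end.
Definition exch12 (d : 'I_3) := match nat_of_ord d with 0 => dig0 | 1 => dig2 | _ => dig1 end.

Definition exchBC r s t (w : E3C_vertex r s t) : E3C_vertex r t s :=
  let: (A, B, C, d) := w in (A, C, B, exch01 d).
Definition exchAB r s t (w : E3C_vertex r s t) : E3C_vertex s r t :=
  let: (A, B, C, d) := w in (B, A, C, exch12 d).

Lemma exch01K : involutive exch01.
Proof. by move=> [[|[|[|//]]] ?]; apply: val_inj. Qed.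

Lemma exch12K : involutive exch12.
Proof. by move=> [[|[|[|//]]] ?]; apply: val_inj. Qed.

Lemma exchBCK r s t : cancel (@exchBC r s t) (@exchBC r t s).
Proof. by move=> [[[A B] C] d]; rewrite /= exch01K. Qed.

Lemma exchABK r s t : cancel (@exchAB r s t) (@exchAB s r t).
Proof. by move=> [[[A B] C] d]; rewrite /= exch12K. Qed.

Lemma exchBC_adj r s t : {homo @exchBC r s t : x y / E3C_adj x y}.
Proof.
move=> [[[A B] C] [[|[|[|//]]] ?]] [[[A' B'] C'] [[|[|[|//]]] ?]];
  rewrite /= ?andbF ?orbF ?andbT //;
  by case: (A == A'); case: (B == B'); case: (C == C').
Qed.

Lemma exchAB_adj r s t : {homo @exchAB r s t : x y / E3C_adj x y}.
Proof.
move=> [[[A B] C] [[|[|[|//]]] ?]] [[[A' B'] C'] [[|[|[|//]]] ?]];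
  rewrite /= ?andbF ?orbF ?andbT //;
  by case: (A == A'); case: (B == B'); case: (C == C').
Qed.

Lemma wide_exchBC r s t n L (u v : E3C_vertex r s t) :
  wide_family (@E3C_adj r t s) n (exchBC u) (exchBC v) L ->
  wide_family (@E3C_adj r s t) n u v L.
Proof.
move=> h; rewrite -(exchBCK u) -(exchBCK v).
by apply: wide_family_map h; [apply: can_inj (@exchBCK _ _ _)|apply: exchBC_adj].
Qed.

Lemma wide_exchAB r s t n L (u v : E3C_vertex r s t) :
  wide_family (@E3C_adj s r t) n (exchAB u) (exchAB v) L ->
  wide_family (@E3C_adj r s t) n u v L.
Proof.
move=> h; rewrite -(exchABK u) -(exchABK v).
by apply: wide_family_map h; [apply: can_inj (@exchABK _ _ _)|apply: exchAB_adj].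
Qed.

(** * Disjoint paths between vertices of the same layer *)

Ltac absurd_cases := repeat match goal with
  | H : _ /\ _ |- _ => destruct H
  | H : _ \/ _ |- _ => destruct H
  | H : and3 _ _ _ |- _ => destruct H
  | H : and4 _ _ _ _ |- _ => destruct H
  end; subst; match goal with H : ~ _ |- _ => solve [case: (H erefl) | case: H; assumption] end.

(** Refutes a common vertex of two supports: in each layer the equations on its words contradict one
    of the inequalities in the context. *)
Ltac layer_cases := case=> [[[? ?] ?] [[|[|[|//]]] ?]] /= => *; absurd_cases.

Lemma wide_same_far r s t (A A' : word r) (B B' : word s) (C C' : word t) :
  0 < s -> 0 < t -> va A B C != va A' B' C' -> ~~ hamming1 A A' ->
  wide_family (@E3C_adj r s t) (2 * r + 2) (va A B C) (va A' B' C') (r + s + t + 6).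
Proof.
move=> s0 t0 uv hA.
have [B1 [nB1 nB1' hB1]] := third_word B B' s0.
have [C1 [nC1 nC1' hC1]] := third_word C C' t0.
have F := @family_fan r s t A B C A' B' C'.
rewrite (negPf hA) subn0 in F.
have Fb := family1 (@route_b r s t A B C A' B' C' B1 hB1).
have ev : E3C_adj (vc A' B' C') (va A' B' C') by apply: adj_digit.
have Fc := family1 (@route_c r s t A B C A' B' C' C1 _ hC1 ev).
have -> : r + s + t + 6 = (r + s + t + 4).+2 by lia.
rewrite (_ : 2 * r + 2 = 2 * r + (1 + 1)) //.
apply: family_wide (family_cat F (family_cat Fb Fc _) _) => //=; try by layer_cases.
- by move=> ?; absurd_cases.
- by move=> ?; absurd_cases.
Qed.

(** In layer b, the inequality of C and C' separates [route_b] from the two routes replacing the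
    missing fan path and [route_c]. *)
Lemma wide_same_near r s t (A A' : word r) (B B' : word s) (C C' : word t) :
  0 < s -> C != C' -> hamming1 A A' ->
  wide_family (@E3C_adj r s t) (2 * r + 2) (va A B C) (va A' B' C') (r + s + t + 6).
Proof.
move=> s0 /eqP nC hA.
have nA : A <> A' by apply/eqP; apply: contraTneq hA => ->; apply: hamming1_irr.
have [B1 [nB1 nB1' hB1]] := third_word B B' s0.
have F := @family_fan r s t A B C A' B' C'.
rewrite hA in F.
have Fb := family1 (@route_b r s t A B C A' B' C' B1 hB1).
have F1 := family1 (@route_keep_A r s t A B C A' B' C' hA).
have F2 := family1 (@route_keep_A' r s t A B C A' B' C' hA).
have -> : r + s + t + 6 = (r + s + t + 4).+2 by lia.
apply: (@wide_family_leq _ _ _ _ (2 * r - 1 + (1 + (1 + 1)))); first lia.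
have uv : va A B C != va A' B' C' by apply/eqP => -[].
apply: family_wide (family_cat F (family_cat Fb (family_cat F1 F2 _) _) _) => //=; try by layer_cases.
- by move=> ?; absurd_cases.
- by move=> ?; absurd_cases.
Qed.

(** The end points are adjacent, and their edge replaces the missing fan path. *)
Lemma wide_same_adj r s t (A A' : word r) (B : word s) (C : word t) :
  0 < s -> 0 < t -> hamming1 A A' ->
  wide_family (@E3C_adj r s t) (2 * r + 2) (va A B C) (va A' B C) (r + s + t + 6).
Proof.
move=> s0 t0 hA.
have nA : A <> A' by apply/eqP; apply: contraTneq hA => ->; apply: hamming1_irr.
have [B1 [nB1 nB1' hB1]] := third_word B B s0.
have [C1 [nC1 nC1' hC1]] := third_word C C t0.
have F := @family_fan r s t A B C A' B C.
rewrite hA in F.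
have Fb := family1 (@route_b r s t A B C A' B C B1 hB1).
have ev : E3C_adj (vc A' B C) (va A' B C) by apply: adj_digit.
have Fc := family1 (@route_c r s t A B C A' B C C1 _ hC1 ev).
have -> : r + s + t + 6 = (r + s + t + 4).+2 by lia.
apply: (@wide_family_leq _ _ _ _ (2 * r - 1 + (1 + 1)).+1); first lia.
have uv : va A B C != va A' B C by apply/eqP => -[].
apply: family_wide_edge (family_cat F (family_cat Fb Fc _) _) => //=; try by layer_cases.
- by rewrite hA !eqxx !orbT.
- by move=> ?; absurd_cases.
- by move=> ?; absurd_cases.
Qed.

Lemma wide_same r s t (A A' : word r) (B B' : word s) (C C' : word t) :
  0 < s -> 0 < t -> va A B C != va A' B' C' ->
  wide_family (@E3C_adj r s t) (2 * r + 2) (va A B C) (va A' B' C') (r + s + t + 6).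
Proof.
move=> s0 t0 uv; case: (boolP (hamming1 A A')) => hA; last exact: wide_same_far.
case: (eqVneq C C') => [<-|nC]; last exact: wide_same_near.
case: (eqVneq B B') => [<-|nB]; first exact: wide_same_adj.
apply: wide_exchBC; rewrite [r + s + t]addnAC.
exact: (@wide_same_near r t s A A' C C B B').
Qed.

(** * Disjoint paths between vertices of different layers *)

Section Different.
Variables r s t : nat.
Variables (A A' : word r) (B B' : word s) (C C' : word t).
Notation e := (@E3C_adj r s t).
Notation u := (va A B C).
Notation v := (vb A' B' C').
Notation L := (r + s + t + 4).

(** For a = A the path leaves u by a change of layer, and for b = B' it enters v by one; the side
    conditions then keep u and v out of the corresponding parts. *)
Definition pair_set (p : word r * word s) := let: (a, b) := p in
  layers (fun X Y Z => [/\ X = a, Y = B, Z = C & a <> A] \/ (Y = b /\ Z = C'))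
         (fun X Y Z => (X = a /\ Z = C) \/ [/\ X = A', Y = b, Z = C' & b <> B'])
         (fun X Y _ => X = a /\ Y = b).

Lemma route_pair a b : (a == A) || hamming1 A a -> (b == B') || hamming1 B' b ->
  route e u v L (pair_set (a, b)).
Proof.
move=> ha hb; rewrite /pair_set; set S := layers _ _ _.
(* The common middle part; a first step to [a] other than A and a last step from [b] other than B'
   cost one more each. *)
have c : conn e S (r + s + t + 2) (vb a B C) (va A' b C').
  apply: (@conn_leq _ _ _ (s + (t + r.+1).+1)); first lia.
  apply: conn_trans (conn_b B b _) _; first by move=> Y; left.
  apply: (@conn_step _ _ _ _ _ (vc a b C)); [by left|exact: adj_digit|].
  apply: conn_trans (conn_c C C' _) _; first by [].
  apply: (@conn_step _ _ _ _ _ (va a b C')); [by []|exact: adj_digit|].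
  by apply: conn_a; right.
have [x [ux cx]] : exists x, e u x /\ conn e S (r + s + t + 3) x (va A' b C').
  case: (eqVneq a A) ha => [<- _|nA /= ha].
    by exists (vb a B C); split; [exact: adj_digit|apply: conn_leq c; lia].
  exists (va a B C); split; first exact: adj_a.
  rewrite addnS; apply: conn_step c; last exact: adj_digit.
  by left; split=> //; apply/eqP.
case: (eqVneq b B') hb => [<- _|nB /= hb].
  exists x, (va A' b C'); split; [exact: ux|exact: adj_digit|].
  by apply: conn_leq cx; lia.
exists x, (vb A' b C'); split; [exact: ux|by apply: adj_b; rewrite hamming1_sym|].
apply: (@conn_leq _ _ _ (r + s + t + 3 + 1)); first lia.
have Sb : S (vb A' b C') by right; split=> //; apply/eqP.
apply: conn_trans cx _; apply: conn_step (conn_refl _ _ Sb); last exact: adj_digit.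
by right.
Qed.

(** If C and C' differ, they separate the stages before and after the correction of C, so two
    supports can meet only through a common [a] or [b]. If C = C', the stages could also meet at a =
    A' or b = B, which is therefore excluded. *)
Lemma family_pairs (ps : seq (word r * word s)) :
  uniq ps ->
  (forall p, p \in ps -> ((p.1 == A) || hamming1 A p.1) /\ ((p.2 == B') || hamming1 B' p.2)) ->
  (forall p q, p \in ps -> q \in ps -> p.1 = q.1 \/ p.2 = q.2 -> p = q) ->
  (C = C' -> forall p, p \in ps -> p.1 <> A' /\ p.2 <> B) ->
  path_family e u v L (size ps) (fun z => exists2 p, p \in ps & pair_set p z).
Proof.
move=> ups hps inj hC; apply: family_seq => //.
  by move=> [a b] /hps[ha hb]; apply: route_pair.
move=> [a b] [a' b'] z pz qz h h'; apply: inj => //=.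
have hCa : C = C' -> [/\ a <> A', b <> B, a' <> A' & b' <> B].
  by move=> E; have [] := hC E _ pz; have [] := hC E _ qz.
move: z h h' => [[[X Y] Z] [[|[|[|//]]] ?]] /=.
- by move=> [-> _] [-> _]; left.
- move=> [[E1 E2]|[E1 E2 E3 _]] [[F1 F2]|[F1 F2 F3 _]].
  + by left; rewrite -E1.
  + by have [[]] := hCa (etrans (esym E2) F3); rewrite -E1.
  + by have [_ _ []] := hCa (etrans (esym F2) E3); rewrite -F1.
  + by right; rewrite -E2.
- move=> [[E1 E2 E3 _]|[E1 E2]] [[F1 F2 F3 _]|[F1 F2]].
  + by left; rewrite -E1.
  + by have [_ _ _ []] := hCa (etrans (esym E3) F2); rewrite -F1.
  + by have [_ []] := hCa (etrans (esym F3) E2); rewrite -E1.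
  + by right; rewrite -E1.
Qed.

End Different.

Lemma wide_diff_C r s t (A A' : word r) (B B' : word s) (C C' : word t) k :
  0 < r -> 0 < s -> 0 < t -> k <= r -> k <= s -> C != C' ->
  wide_family (@E3C_adj r s t) (2 * k + 2) (va A B C) (vb A' B' C') (r + s + t + 6).
Proof.
move=> r0 s0 t0 kr ks /eqP nC.
have [A1 [/eqP nA1 nA1' hA1]] := third_word A A' r0.
have [B1 [/eqP nB1 nB1' hB1]] := third_word B' B s0.
have [C1 [nC1 nC1' hC1]] := third_word C C' t0.
have hd1 m (X Y : word m) : Y != X -> hdist X Y <= 1 -> hamming1 X Y.
  move=> nXY h; apply/eqP/eqP; rewrite eqn_leq h lt0n.
  have [i hi] := neq_word nXY; rewrite eq_sym in hi.
  by rewrite -/(hdist X Y) (hdist_upd hi).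
have {}hA1 := hd1 _ _ _ nA1 hA1; have {}hB1 := hd1 _ _ _ nB1 hB1.
(* The lists start with the pairs (A, B1) and (A1, B'), so that no pair is (A, B) or (A', B'), the
   two places in layer c used by [route_c]. *)
pose al := A :: A1 :: rem A1 (nbrs A); pose be := B1 :: B' :: rem B1 (nbrs B').
have memn m (X Y Z : word m) : Z \in rem Y (nbrs X) -> [/\ Z != X, Z != Y & hamming1 X Z].
  rewrite mem_rem_uniq ?nbrs_uniq // !inE mem_nbrs => /andP[-> h]; split=> //.
  by apply: contraTneq h => ->; apply: hamming1_irr.
have ual : uniq al.
  rewrite /= !inE negb_or eq_sym nA1 rem_uniq ?nbrs_uniq // andbT; apply/andP; split.
    by apply/negP => /memn[/eqP].
  by apply/negP => /memn[_ /eqP].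
have ube : uniq be.
  rewrite /= !inE negb_or nB1 rem_uniq ?nbrs_uniq // andbT; apply/andP; split.
    by apply/negP => /memn[_ /eqP].
  by apply/negP => /memn[/eqP].
have sz m (X Y : word m) : hamming1 X Y -> (size (rem Y (nbrs X))).+1 = 2 * m.
  move=> h; rewrite size_rem ?mem_nbrs // prednK ?size_nbrs //.
  by rewrite -(size_nbrs X) lt0n size_eq0; apply: contraTneq h; rewrite -mem_nbrs => ->.
have szs : 2 * k + 1 <= size (zip al be).
  by rewrite size_zip leq_min /= !sz //; lia.
have hps p : p \in zip al be ->
   [/\ (p.1 == A) || hamming1 A p.1, (p.2 == B') || hamming1 B' p.2,
       p <> (A, B) & p <> (A', B')].
  rewrite /= !inE => /or3P[/eqP->|/eqP->|/mem_zip_split[/memn[/eqP n1 n2 ->] /memn[/eqP n3 n4 ->]]].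
  - rewrite /= eqxx hB1 orbT; split=> //; first by move/(congr1 snd).
    by move/(congr1 snd)/eqP; rewrite (negPf nB1).
  - rewrite /= eqxx hA1 orbT; split=> //; last by move/(congr1 fst).
    by move/(congr1 fst)/eqP; rewrite (negPf nA1).
  by rewrite !orbT; split=> // E; move: n1 n3; rewrite E.
have F : path_family _ (va A B C) (vb A' B' C') _ _ _ :=
  @family_pairs r s t A A' B B' C C' (zip al be)
  (zip_uniq_pair be ual)
  (fun p h => let: And4 h1 h2 _ _ := hps p h in conj h1 h2)
  (fun p q => @zip_uniq_eq _ _ al be p q ual ube) (fun E => False_ind _ (nC E)).
have ev : E3C_adj (vc A' B' C') (vb A' B' C') by apply: adj_digit.
have Fc := family1 (@route_c r s t A B C A' B' C' C1 _ hC1 ev).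
have -> : r + s + t + 6 = (r + s + t + 4).+2 by lia.
apply: (@wide_family_leq _ _ _ _ (size (zip al be) + 1)); first lia.
apply: family_wide (family_cat F Fc _).
- by apply/eqP.
- by move=> [[[a b] _] /= ?|/= ?]; absurd_cases.
- by move=> [[[a b] _] /= ?|/= ?]; absurd_cases.
move=> z [[a b] /hps[_ _ n1 n2]]; move: z.
by layer_cases.
Qed.

(** If X and Y differ at [i], the neighbour with digit [i] corrected is reserved for one extra walk,
    which keeps that digit correct (the set [T]). X and its other neighbours have digit [i] wrong,
    hence avoid both [T] and Y. If X = Y, all neighbours serve and no walk is reserved. *)
Lemma detours m (X Y : word m) : exists (a : seq (word m)) (T : word m -> Prop),
  [/\ uniq a, 2 * m <= size a,
      forall N, N \in a -> [/\ (N == X) || hamming1 X N, N <> Y & ~ T N], ~ T X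
    & X = Y \/ exists2 W, hamming1 X W & conn (@hamming1 m) T m W Y].
Proof.
case: (eqVneq X Y) => [<-|/neq_word[i hi]].
  exists (nbrs X), (fun=> False); split; rewrite ?nbrs_uniq ?size_nbrs //; last by left.
  move=> N; rewrite mem_nbrs => h; rewrite h orbT; split=> // E.
  by move: h; rewrite E; apply/negP/hamming1_irr.
have hW : hamming1 X (upd X i (Y i)) by rewrite hamming1_upd // eq_sym.
set W := upd X i (Y i) in hW.
have nX N : N \in rem W (nbrs X) -> hamming1 X N /\ N i <> Y i.
  rewrite mem_rem_uniq ?nbrs_uniq // !inE mem_nbrs => /andP[nW h]; split=> // E.
  have [k hk EN] := hamming1P h; case: (eqVneq i k) => ik.
    by move: nW; rewrite EN -ik E eqxx.
  by move: hi; rewrite -E EN upd_other // eqxx.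
exists (X :: rem W (nbrs X)), (fun Z => Z i = Y i); split.
- rewrite /= rem_uniq ?nbrs_uniq // andbT; apply/negP => /nX[].
  by rewrite (negPf (hamming1_irr X)).
- by rewrite /= size_rem ?mem_nbrs // size_nbrs; lia.
- move=> N; rewrite inE => /orP[/eqP->|/nX[h E]].
    by rewrite eqxx; split=> //; [move=> E; move: hi; rewrite E eqxx|apply/eqP].
  by rewrite h orbT; split=> // EN; apply: E; rewrite EN.
- exact/eqP.
right; exists W => //; apply: conn_leq (hdist_le W Y) _.
apply: (@conn_map _ _ _ _ id) (conn_box W Y) => // Z /(_ i) [] //.
by rewrite upd_same.
Qed.

(** Besides the 2k pairs and [route_c], the last path is the edge uv if A = A' and B = B'. Otherwise
    it changes A and then B along the reserved walks of [detours], without visiting layer c. *)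
Lemma wide_diff_sameC r s t (A A' : word r) (B B' : word s) (C : word t) k :
  0 < t -> k <= r -> k <= s ->
  wide_family (@E3C_adj r s t) (2 * k + 2) (va A B C) (vb A' B' C) (r + s + t + 6).
Proof.
move=> t0 kr ks.
have [C1 [nC1 _ hC1]] := third_word C C t0.
have [al [T [ual sal hal TA dA]]] := detours A A'.
have [be [U [ube sbe hbe UB dB]]] := detours B' B.
have F : path_family (@E3C_adj r s t) (va A B C) (vb A' B' C) (r + s + t + 4)
  (size (zip al be)) (fun z => exists2 p, p \in zip al be & pair_set A A' B B' C C p z).
  apply: family_pairs.
  - exact: zip_uniq_pair.
  - by move=> p /mem_zip_split[/hal[-> _ _] /hbe[-> _ _]].
  - by move=> p q; apply: zip_uniq_eq.
  by move=> _ p /mem_zip_split[/hal[_ h _] /hbe[_ h' _]].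
have szs : 2 * k <= size (zip al be) by rewrite size_zip leq_min; lia.
have ev : E3C_adj (vc A' B' C) (vb A' B' C) by apply: adj_digit.
have Fc := family1 (@route_c r s t A B C A' B' C C1 _ hC1 ev).
pose Sd := layers (fun (X : word r) (Y : word s) (Z : word t) => [/\ T X, Y = B & Z = C])
                  (fun X Y Z => [/\ X = A', U Y & Z = C]) (fun _ _ _ => False).
have uv : va A B C != vb A' B' C by apply/eqP.
have -> : r + s + t + 6 = (r + s + t + 4).+2 by lia.
have cB : B' <> B -> exists2 B1, hamming1 B' B1
    & conn (@E3C_adj r s t) Sd s (vb A' B C) (vb A' B1 C).
  case: dB => // -[B1 h /(conn_sym (@hamming1_sym s)) c] _; exists B1 => //.
  by apply: conn_b_in c _ => Y UY.
have U_FFc z : (exists2 p, p \in zip al be & pair_set A A' B B' C C p z) ->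
  layers (fun _ Y Z => Y = B /\ Z = C1) (fun X _ Z => X = A' /\ Z = C1)
            (fun X Y _ => (X = A /\ Y = B) \/ (X = A' /\ Y = B')) z -> False.
  move=> [[a b] /mem_zip_split[/hal[_ /= n1 _] /hbe[_ /= n2 _]]]; move: z.
  by layer_cases.
case: (boolP ((A == A') && (B' == B))) => [/andP[/eqP EA /eqP EB]|].
  apply: (@wide_family_leq _ _ _ _ (size (zip al be) + 1).+1); first lia.
  apply: family_wide_edge uv _ _ _ (family_cat F Fc U_FFc).
  - by rewrite EA EB; apply: adj_digit.
  - move=> [[[a b] /mem_zip_split[/hal[_ /= n1 _] /hbe[_ /= n2 _]]] /= ?|/= ?];
      by absurd_cases.
  - move=> [[[a b] /mem_zip_split[/hal[_ /= n1 _] /hbe[_ /= n2 _]]] /= ?|/= ?];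
      by absurd_cases.
rewrite negb_and => dif.
have Rd : route (@E3C_adj r s t) (va A B C) (vb A' B' C) (r + s + t + 4) Sd.
  case: dA => [EA|[A1 hA1 cA]].
    have [|B1 hB1 c] := cB; first by apply/eqP; move: dif; rewrite EA eqxx.
    exists (vb A' B C), (vb A' B1 C); split.
    - by rewrite EA; apply: adj_digit.
    - by apply: adj_b; rewrite hamming1_sym.
    by apply: conn_leq c; lia.
  have {}cA : conn (@E3C_adj r s t) Sd r (va A1 B C) (va A' B C).
    by apply: conn_a_in cA _ => X TX.
  have SA' := conn_end cA.
  case: (eqVneq B' B) => [EB|/eqP/cB[B1 hB1 c]].
    exists (va A1 B C), (va A' B C); split; first exact: adj_a.
      by rewrite EB; apply: adj_digit.
    by apply: conn_leq cA; lia.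
  exists (va A1 B C), (vb A' B1 C); split; first exact: adj_a.
    by apply: adj_b; rewrite hamming1_sym.
  apply: (@conn_leq _ _ _ (r + s.+1)); first lia.
  apply: conn_trans cA _; by apply: conn_step c; last exact: adj_digit.
apply: (@wide_family_leq _ _ _ _ (size (zip al be) + 1 + 1)); first lia.
apply: family_wide uv _ _ (family_cat (family_cat F Fc U_FFc) (family1 Rd) _).
- move=> [[[[a b] /mem_zip_split[/hal[_ /= n1 _] /hbe[_ /= n2 _]]] /= ?|/= ?]|/= [] //].
    by absurd_cases.
  by absurd_cases.
- move=> [[[[a b] /mem_zip_split[/hal[_ /= n1 _] /hbe[_ /= n2 _]]] /= ?|/= ?]|/= [] //].
    by absurd_cases.
  by absurd_cases.
move=> z [[[a b] /mem_zip_split[/hal[_ /= n1 n1'] /hbe[_ /= n2 n2']]]|]; move: z; rewrite /Sd;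
  by case=> [[[? ?] ?] [[|[|[|//]]] ?]] //= => *; absurd_cases.
Qed.

Lemma wide_diff r s t (A A' : word r) (B B' : word s) (C C' : word t) k :
  0 < k -> k <= r -> k <= s -> k <= t ->
  wide_family (@E3C_adj r s t) (2 * k + 2) (va A B C) (vb A' B' C') (r + s + t + 6).
Proof.
move=> k0 kr ks kt; have [r0 s0 t0] : [/\ 0 < r, 0 < s & 0 < t] by split; lia.
case: (eqVneq C C') => [<-|nC]; first exact: wide_diff_sameC.
exact: wide_diff_C.
Qed.

Lemma digitE (d : 'I_3) : [\/ d = dig0, d = dig1 | d = dig2].
Proof.
case: d => [[|[|[|//]]] ?]; [apply: Or31|apply: Or32|apply: Or33]; exact: val_inj.
Qed.

Lemma wide_E3C r s t k (u v : E3C_vertex r s t) :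
  0 < k -> k <= r -> k <= s -> k <= t -> u != v ->
  wide_family (@E3C_adj r s t) (2 * k + 2) u v (r + s + t + 6).
Proof.
move=> k0 kr ks kt.
have same a b c (A A' : word a) (B B' : word b) (C C' : word c) :
    k <= a -> k <= b -> k <= c -> (A, B, C) != (A', B', C') ->
    wide_family (@E3C_adj a b c) (2 * k + 2) (va A B C) (va A' B' C') (a + b + c + 6).
  move=> ka kb kc n; apply: (@wide_family_leq _ _ _ _ (2 * a + 2)); first lia.
  apply: wide_same; [lia|lia|].
  by apply: contraNneq n => -[-> -> ->].
have eBC a b c : a + b + c = a + c + b by rewrite addnAC.
have eAB a b c : a + b + c = b + a + c by rewrite (addnC a).
case: u v => [[[A B] C] d] [[[A' B'] C'] d'] n.
have nw : d = d' -> (A, B, C) != (A', B', C') by move=> E; apply: contraNneq n => ->; rewrite E.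
(* In each of the nine cases, exchanges bring the layers of u and v to a and a, or to a and b in
   this order. *)
case: (digitE d) => ?; subst d; case: (digitE d') => ?; subst d'.
- apply: wide_exchBC; apply: wide_exchAB; rewrite (eBC r s t) (eAB r t s); apply: same => //.
  by apply: contraNneq (nw erefl) => -[-> -> ->].
- apply: wide_exchAB; apply: wide_exchBC; apply: wide_exchAB.
  by rewrite (eAB r s t) (eBC s r t) (eAB s t r); apply: wide_diff.
- by apply: wide_exchBC; apply: wide_exchAB; rewrite (eBC r s t) (eAB r t s); apply: wide_diff.
- by apply: wide_exchAB; apply: wide_exchBC; rewrite (eAB r s t) (eBC s r t); apply: wide_diff.
- apply: wide_exchAB; rewrite (eAB r s t); apply: same => //.
  by apply: contraNneq (nw erefl) => -[-> -> ->].
- by apply: wide_exchAB; rewrite (eAB r s t); apply: wide_diff.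
- by apply: wide_exchBC; rewrite (eBC r s t); apply: wide_diff.
- exact: wide_diff.
- by apply: same => //; apply: nw.
Qed.

(** * The lower bound *)

Section LowerBound.
Variables r s t : nat.
Variables (A' : word r) (B' : word s) (C' : word t).

(* A lower bound for the distance to [va A' B' C']: the number of wrong digits
   plus the number of changes of layer still needed to correct B and C and to
   return to the layer of [va]. *)
Definition potential (w : E3C_vertex r s t) : nat :=
  let: (X, Y, Z, d) := w in
  hdist X A' + hdist Y B' + hdist Z C' +
  match nat_of_ord d with
  | 0 => 1 + (Y != B')
  | 1 => 1 + (Z != C')
  | _ => (Y != B') + (Z != C') + ((Y != B') || (Z != C'))
  end.

(** The layer term ignores the word that its layer can change, so a move inside a layer affects one
    Hamming distance only. A change of layer fixes the words and lowers the layer term by at most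
    1. *)
Lemma potential_step x y : E3C_adj x y -> potential x <= (potential y).+1.
Proof.
move: x y => [[[X Y] Z] [[|[|[|//]]] ?]] [[[X' Y'] Z'] [[|[|[|//]]] ?]];
  rewrite /= ?andbF ?orbF ?andbT //=.
- by move=> /and3P[/eqP-> /eqP-> /(hdist_hamming1 C')]; lia.
- by move=> /and3P[/eqP-> /eqP-> /eqP->]; do 2 case: eqP; lia.
- by move=> /and3P[/eqP-> /eqP-> /eqP->]; do 2 case: eqP; lia.
- by move=> /and3P[/eqP-> /eqP-> /eqP->]; do 2 case: eqP; lia.
- by move=> /and3P[/eqP-> /eqP-> /(hdist_hamming1 B')]; lia.
- by move=> /and3P[/eqP-> /eqP-> /eqP->]; do 2 case: eqP; lia.
- by move=> /and3P[/eqP-> /eqP-> /eqP->]; do 2 case: eqP; lia.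
- by move=> /and3P[/eqP-> /eqP-> /eqP->]; do 2 case: eqP; lia.
- by move=> /and3P[/eqP-> /eqP-> /(hdist_hamming1 A')]; lia.
Qed.

Lemma potential_path x p :
  path (@E3C_adj r s t) x p -> potential x <= size p + potential (last x p).
Proof.
elim: p x => [|y p IH] x // /andP[/potential_step h /IH h'].
by apply: leq_trans h _; rewrite addSn ltnS.
Qed.

Lemma potential_end : potential (va A' B' C') = 0.
Proof. by rewrite /= !hdist_xx !eqxx. Qed.

End LowerBound.

Lemma adj_aE r s t (A : word r) (B : word s) (C : word t) w :
  E3C_adj (va A B C) w ->
  [\/ w = vc A B C, w = vb A B C | exists j, w = va (nbr A j) B C].
Proof.
case: w => [[[X Y] Z] d]; case: (digitE d) => -> /=; rewrite ?andbF ?orbF ?andbT.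
- by move=> /and3P[/eqP-> /eqP-> /eqP->]; apply: Or31.
- by move=> /and3P[/eqP-> /eqP-> /eqP->]; apply: Or32.
- by move=> /and3P[/eqP-> /eqP-> /nbrP[j ->]]; apply: Or33; exists j.
Qed.

Lemma hdist_max m (X Y : word m) : (forall i, X i != Y i) -> hdist X Y = m.
Proof. by move=> h; rewrite -[RHS](card_ord m); apply: eq_card => i; rewrite !inE h. Qed.

Lemma fault_diam_ge r s t : 0 < r -> 0 < s -> 0 < t ->
  r + s + t + 4 <= fault_diam (@E3C_adj r s t) (2 * r + 1).
Proof.
move=> r0 s0 t0.
pose zero m : word m := [ffun=> dig0]; pose one m : word m := [ffun=> dig1].
have z1 m : hdist (zero m) (one m) = m.
  by apply: hdist_max => i; rewrite !ffunE.
have n1 m : 0 < m -> zero m != one m.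
  by move=> m0; apply: contraTneq m0 => E; rewrite -(z1 m) E hdist_xx.
pose u : E3C_vertex r s t := va (zero r) (zero s) (zero t).
pose v : E3C_vertex r s t := va (one r) (one s) (one t).
(* The only neighbour of [u] left alive changes a digit of A to the wrong value 2. *)
pose j0 : 'I_r * bool := (Ordinal r0, true).
pose F : {set E3C_vertex r s t} :=
  vb (zero r) (zero s) (zero t) |: (vc (zero r) (zero s) (zero t) |:
  [set va (nbr (zero r) j) (zero s) (zero t) | j in [set~ j0]]).
have cF : #|F| == 2 * r + 1.
  rewrite !cardsU1 card_imset; last by move=> i j [] /nbr_inj.
  rewrite cardsC1 card_prod card_ord card_bool !inE.
  rewrite (_ : _ \in _ = false); last by apply/imsetP => -[].
  rewrite (_ : _ \in _ = false); last by apply/imsetP => -[].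
  rewrite (_ : (vb _ _ _ == vc _ _ _) = false); last by apply/eqP.
  by rewrite /=; apply/eqP; lia.
have uF : u \notin F.
  rewrite !inE !negb_or; apply/and3P; split; [exact/eqP|exact/eqP|].
  apply/imsetP => -[j _ [E]].
  by have := hamming1_nbr (zero r) j; rewrite -E; apply/negP/hamming1_irr.
have nb : one s <> zero s by apply/eqP; rewrite eq_sym n1.
have vF : v \notin F.
  rewrite !inE !negb_or; apply/and3P; split; [exact/eqP|exact/eqP|].
  by apply/imsetP => -[j _ [_ /nb]].
have uv : u != v by apply/eqP => -[_ /esym /nb].
rewrite /fault_diam (leq_trans _ (leq_bigmax u)) // (leq_trans _ (leq_bigmax v)) //.
rewrite (leq_trans _ (leq_bigmax_cond F _)) ?uv ?uF ?vF //.
(* This rules out the default value: a distance below r + s + t + 4 is at most #|V|, hence realised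
   by a path. *)
have big : r + s + t + 4 <= #|E3C_vertex r s t|.+1.
  rewrite !card_prod !card_ffun !card_ord -!expnD.
  by have := ltn_expl (r + s + t) (isT : 1 < 3); rewrite -expnSr expnS; lia.
case: leqP => // lt; have := leq_trans lt big; rewrite ltnS => /least_upto_spec.
rewrite -/(dist_avoid _ _ _ _); move: (dist_avoid _ _ _ _) lt => k lt.
move=> [p [[hp sp lp pp up] [sz aF]]].
case: p hp sp lp pp {up} sz aF => // x [|w p] /= -> _; first by move=> E; rewrite E eqxx in uv.
move=> lp /andP[/adj_aE aw pw] sz /and3P[_ wF _].
have Ew : w = va (nbr (zero r) j0) (zero s) (zero t).
  case: aw wF => [->|->|[j ->]]; rewrite !inE ?eqxx ?orbT //=.
  case: (eqVneq j j0) => [-> //|nj]; case/negP.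
  by apply/or3P/Or33/imsetP; exists j; rewrite // !inE.
(* At [w] all r + s + t digits are still wrong and the layer term is 3; the edge from u to [w] adds
   the last unit. *)
have := potential_path (one r) (one s) (one t) pw.
rewrite lp potential_end Ew /= !z1 !n1 // hdist_max; last first.
  by move=> i; rewrite /nbr !ffunE; case: (i == _).
by lia.
Qed.

Theorem theorem3 (r s t : nat) :
  1 <= r -> r <= s -> s <= t ->
  let n := r + s + t + 1 in
  [/\ n + 3 = r + s + t + 4,
      r + s + t + 4 <= fault_diam (@E3C_adj r s t) (2 * r + 1),
      fault_diam (@E3C_adj r s t) (2 * r + 1) <= wide_diam (@E3C_adj r s t) (2 * r + 2)
    & wide_diam (@E3C_adj r s t) (2 * r + 2) <= r + s + t + 6 /\ r + s + t + 6 = n + 5].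
Proof.
move=> r0 rs st n; split; [by rewrite /n; lia| | |split; last by rewrite /n; lia].
- by apply: fault_diam_ge; lia.
- by rewrite [2 * r + 2]addnS; apply: fault_le_wide.
apply/bigmax_leqP => u _; apply/bigmax_leqP => v uv.
by apply: least_upto_le; apply: wide_E3C => //; lia.
Qed.
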